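(* Let $M_6$ be the Turing machine with states $A,B,C,D,E,F$ (plus the halting state $H$), symbols $0,1$ ($0$ blank) and transition table $\delta(A,0)=(1,R,B)$, $\delta(A,1)=(0,R,F)$; $\delta(B,0)=(0,L,B)$, $\delta(B,1)=(1,L,C)$; $\delta(C,0)=(1,L,D)$, $\delta(C,1)=(0,R,C)$; $\delta(D,0)=(1,L,E)$, $\delta(D,1)=(1,R,H)$; $\delta(E,0)=(1,L,F)$, $\delta(E,1)=(0,L,D)$; $\delta(F,0)=(1,R,A)$, $\delta(F,1)=(0,L,E)$. For integers $n,p \ge 0$ let $C(n,p) = {}^\omega 0\,(F0)\,(1\,0)^n\,\mathrm{R}(\mathrm{bin}(p))\,0^\omega$ (so that $C(k,4m+1)=C(k+1,m)$). Then (a) ${}^\omega 0(A0)0^\omega \vdash(6)\ C(0,15)$, and, for all integers $k,m\ge 0$: (b) $C(k,4m+3) \vdash(4k+6)\ C(k+2,m)$; (c) $C(2k,4m) \vdash(30k^2+20k+15)\ C(5k+2,2m+1)$; (d) $C(2k+1,4m) \vdash(30k^2+40k+25)\ C(5k+2,32m+20)$; (e) $C(k,8m+2) \vdash(8k+20)\ C(k+3,2m+1)$; (f) $C(2k,16m+6) \vdash(30k^2+40k+23)\ C(5k+2,32m+20)$; (g) $C(2k+1,16m+6) \vdash(30k^2+80k+63)\ C(5k+7,2m+1)$; (h) $C(k,32m+14) \vdash(4k+18)\ C(k+3,2m+1)$; (i) $C(2k,128m+94) \vdash(30k^2+40k+39)\ C(5k+2,256m+84)$; (j) $C(2k+1,128m+94)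 \vdash(30k^2+80k+79)\ C(5k+9,m)$; (k) $C(k,256m+190) \vdash(4k+34)\ C(k+5,m)$; (l) $C(k,512m+30) \vdash(2k+43)\ {}^\omega 0\,(1\,0)^k\,1\,(H0)\,(1\,0)^2\,(0\,1)^2\,\mathrm{R}(\mathrm{bin}(m))\,0^\omega$.
   Context: Turing machines here have one tape, infinite in both directions. $\delta(q,a)=(b,D,q')$ means: in state $q$ reading symbol $a$, the machine writes $b$ on the current cell, moves the head one cell left ($D=L$) or right ($D=R$), and enters state $q'$. When the machine enters the halting state $H$ it stops. A configuration is written ${}^\omega 0\, x\,(S a)\, y\, 0^\omega$, where $x,y$ are finite words: the tape contains the word $xay$ surrounded on both sides by infinitely many $0$'s, the machine is in state $S$, and the head scans the cell containing the displayed symbol $a$. Each digit is one tape symbol; $w^n$ denotes the concatenation of $n$ copies of the word $w$ (parentheses delimit the repeated word), $w^0$ is empty. $\mathrm{bin}(p)$ is the usual binary writing of $p$ (most significant bit first; for $p=0$ one may take it empty, which gives the same configuration since it is followed by $0^\omega$), and $\mathrm{R}(w_1\ldots w_n) = w_n\ldots w_1$ is the reversal of a word. $C_1 \vdash(t)\ C_2$ means that the machine, started in configuration $C_1$, is in configuration $C_2$ after exactly $t$ steps. *)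

(* Defs.v *)
From Stdlib Require Import ZArith NArith List.
Import ListNotations.

Inductive symbol := s0 | s1.

Definition word := list symbol.

Inductive direction := L | R.

(* [None] means that the machine stops. *)
Definition machine (Q : Type) := Q -> symbol -> option (symbol * direction * Q).

Record configuration (Q : Type) := Configuration {
  state : Q;
  tape : Z -> symbol;
  head_pos : Z
}.
Arguments Configuration {Q} _ _ _.
Arguments state {Q} _.
Arguments tape {Q} _ _.
Arguments head_pos {Q} _.

Definition write (t : Z -> symbol) (i : Z) (b : symbol) : Z -> symbol :=
  fun j => if Z.eqb j i then b else t j.

Definition move (d : direction) (i : Z) : Z :=
  match d with L => Z.pred i | R => Z.succ i end.

Definition step {Q : Type} (M : machine Q) (c : configuration Q) :
    option (configuration Q) :=
  match M (state c) (tape c (head_pos c)) with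
  | Some (b, d, q) =>
      Some (Configuration q (write (tape c) (head_pos c) b) (move d (head_pos c)))
  | None => None
  end.

Fixpoint steps {Q : Type} (M : machine Q) (t : nat) (c : configuration Q) :
    option (configuration Q) :=
  match t with
  | O => Some c
  | S t' => match step M c with Some c' => steps M t' c' | None => None end
  end.

(* Written configurations carry no absolute cell addresses, so they are
   compared up to a translation of the tape. *)
Definition same_configuration {Q : Type} (c1 c2 : configuration Q) : Prop :=
  state c1 = state c2 /\
  forall i : Z, tape c1 (head_pos c1 + i)%Z = tape c2 (head_pos c2 + i)%Z.

(* C1 |-(t) C2 *)
Definition reaches_in {Q : Type} (M : machine Q) (t : nat)
    (c1 c2 : configuration Q) : Prop :=
  exists c, steps M t c1 = Some c /\ same_configuration c c2.

(* ^w0 x (q a) y 0^w, with the word x a y placed on the cells 0, 1, 2, ... *)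
Definition written {Q : Type} (x : word) (q : Q) (a : symbol) (y : word) :
    configuration Q :=
  Configuration q
    (fun i => if Z.ltb i 0 then s0 else nth (Z.to_nat i) (x ++ a :: y) s0)
    (Z.of_nat (length x)).

Definition wpow (w : word) (n : nat) : word := concat (repeat w n).

Fixpoint bin_pos (p : positive) : word :=
  match p with
  | xH => [s1]
  | xO q => bin_pos q ++ [s0]
  | xI q => bin_pos q ++ [s1]
  end.

(* Most significant bit first; [bin 0] is empty. *)
Definition bin (p : nat) : word :=
  match N.of_nat p with N0 => [] | Npos q => bin_pos q end.

Inductive state6 := qA | qB | qC | qD | qE | qF | qH.

Definition M6 : machine state6 := fun q a =>
  match q, a with
  | qA, s0 => Some (s1, R, qB)
  | qA, s1 => Some (s0, R, qF)
  | qB, s0 => Some (s0, L, qB)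
  | qB, s1 => Some (s1, L, qC)
  | qC, s0 => Some (s1, L, qD)
  | qC, s1 => Some (s0, R, qC)
  | qD, s0 => Some (s1, L, qE)
  | qD, s1 => Some (s1, R, qH)
  | qE, s0 => Some (s1, L, qF)
  | qE, s1 => Some (s0, L, qD)
  | qF, s0 => Some (s1, R, qA)
  | qF, s1 => Some (s0, L, qE)
  | qH, _ => None
  end.

Definition C (n p : nat) : configuration state6 :=
  written [] qF s0 (wpow [s1; s0] n ++ rev (bin p)).

(* Main.v *)
Require Import Defs.
From Stdlib Require Import Arith List ZArith Lia.
Import ListNotations.

(** Write [P n Y] for the head in state [F] on the blank left of [(10)^n Y].
    Two rewriting rules, [P n (11 Y) |- P (n+2) Y] and
    [P n (010 Y) |- P (n+3) (1 Y)], each obtained from one or two sweeps over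
    the block [(10)^n], combine into [P n (0101 Y) |- P (n+5) Y].  In the
    quadratic cases a first sweep to the left turns the block [(10)^n] into
    [11 (01)^n]; the combined rule then eats [(01)^n] two blocks at a time
    while the new block [(10)^i] grows from [i = 2] by [5] each time, whence
    the factor [5k] and the quadratic running times.  The other cases need a
    bounded number of sweeps. *)

(** * Finite descriptions of configurations *)

(* The left word lists the cells starting from the one next to the head. *)
Record zipper (Q : Type) := Zipper {
  zstate : Q;
  zleft : word;
  zhead : symbol;
  zright : word
}.
Arguments Zipper {Q} _ _ _ _.
Arguments zstate {Q} _.
Arguments zleft {Q} _.
Arguments zhead {Q} _.
Arguments zright {Q} _.

Definition zmove {Q : Type} (d : direction) (q : Q) (l : word) (b : symbol)
    (r : word) : zipper Q :=
  match d with
  | L => Zipper q (tl l) (hd s0 l) (b :: r)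
  | R => Zipper q (b :: l) (hd s0 r) (tl r)
  end.

Definition zstep {Q : Type} (M : machine Q) (z : zipper Q) :
    option (zipper Q) :=
  match M (zstate z) (zhead z) with
  | Some (b, d, q) => Some (zmove d q (zleft z) b (zright z))
  | None => None
  end.

Fixpoint zsteps {Q : Type} (M : machine Q) (t : nat) (z : zipper Q) :
    option (zipper Q) :=
  match t with
  | O => Some z
  | S t' => match zstep M z with Some z' => zsteps M t' z' | None => None end
  end.

Lemma zsteps_trans {Q : Type} (M : machine Q) (t1 t2 : nat)
    (z1 z2 z3 : zipper Q) :
  zsteps M t1 z1 = Some z2 -> zsteps M t2 z2 = Some z3 ->
  zsteps M (t1 + t2) z1 = Some z3.
Proof.
  revert z1; induction t1 as [|t1 IH]; intros z1; simpl.
  - now intros [= ->].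
  - destruct (zstep M z1); [apply IH | discriminate].
Qed.

Definition ztape {Q : Type} (z : zipper Q) (i : Z) : symbol :=
  match i with
  | Z0 => zhead z
  | Zpos p => nth (pred (Pos.to_nat p)) (zright z) s0
  | Zneg p => nth (pred (Pos.to_nat p)) (zleft z) s0
  end.

(** Cells are addressed relative to the head, so one zipper describes all translates of a
    configuration. *)
Definition describes {Q : Type} (z : zipper Q) (c : configuration Q) : Prop :=
  state c = zstate z /\
  forall i : Z, tape c (head_pos c + i)%Z = ztape z i.

Lemma ztape_pos {Q : Type} (z : zipper Q) (i : Z) :
  (0 < i)%Z -> ztape z i = nth (Z.to_nat (i - 1)) (zright z) s0.
Proof. destruct i; try lia; intros _; simpl ztape; f_equal; lia. Qed.

Lemma ztape_neg {Q : Type} (z : zipper Q) (i : Z) :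
  (i < 0)%Z -> ztape z i = nth (Z.to_nat (- i - 1)) (zleft z) s0.
Proof. destruct i; try lia; intros _; simpl ztape; f_equal; lia. Qed.

Lemma nth_tl (w : word) (i : nat) : nth i (tl w) s0 = nth (S i) w s0.
Proof. destruct w; [destruct i|]; reflexivity. Qed.

Lemma nth_hd (w : word) : nth 0 w s0 = hd s0 w.
Proof. destruct w; reflexivity. Qed.

(** The new head lies at offset [move d 0] from the old one. The default [s0] of [hd] and [nth]
    supplies the blanks beyond either word. *)
Lemma ztape_zmove {Q : Type} (z : zipper Q) (d : direction) (q : Q)
    (b : symbol) (i : Z) :
  ztape (zmove d q (zleft z) b (zright z)) i =
  if Z.eqb (move d 0 + i) 0 then b else ztape z (move d 0 + i).
Proof.
  destruct (Z.eqb_spec (move d 0 + i) 0) as [E|E].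
  - destruct d; unfold move in E.
    + replace i with 1%Z by lia; reflexivity.
    + replace i with (-1)%Z by lia; reflexivity.
  - destruct (Z.lt_trichotomy (move d 0 + i) 0) as [H|[H|H]]; [|lia|].
    + rewrite (ztape_neg z) by assumption; destruct d; unfold move in *.
      * destruct (Z.eq_dec i 0) as [->|Hi].
        -- symmetry; apply nth_hd.
        -- rewrite ztape_neg by lia; simpl zleft; rewrite nth_tl; f_equal; lia.
      * rewrite ztape_neg by lia; simpl zleft.
        replace (Z.to_nat (- i - 1))
          with (S (Z.to_nat (- (Z.succ 0 + i) - 1))) by lia.
        reflexivity.
    + rewrite (ztape_pos z) by assumption; destruct d; unfold move in *.
      * rewrite ztape_pos by lia; simpl zright.
        replace (Z.to_nat (i - 1))
          with (S (Z.to_nat (Z.pred 0 + i - 1))) by lia.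
        reflexivity.
      * destruct (Z.eq_dec i 0) as [->|Hi].
        -- symmetry; apply nth_hd.
        -- rewrite ztape_pos by lia; simpl zright; rewrite nth_tl; f_equal; lia.
Qed.

Lemma describes_step {Q : Type} (M : machine Q) (z z' : zipper Q)
    (c : configuration Q) :
  describes z c -> zstep M z = Some z' ->
  exists c', step M c = Some c' /\ describes z' c'.
Proof.
  intros [Hs Ht]; unfold zstep, step.
  pose proof (Ht 0%Z) as H0; rewrite Z.add_0_r in H0; simpl in H0.
  rewrite Hs, H0.
  destruct (M (zstate z) (zhead z)) as [[[b d] q]|]; [|discriminate].
  intros [= <-]; eexists; split; [reflexivity|split].
  - destruct d; reflexivity.
  - intros i; rewrite ztape_zmove, <- Ht; cbn [tape head_pos]; unfold write.
    replace (move d (head_pos c) + i)%Z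
      with (head_pos c + (move d 0 + i))%Z by (destruct d; unfold move; lia).
    destruct (Z.eqb_spec (head_pos c + (move d 0 + i)) (head_pos c)),
      (Z.eqb_spec (move d 0 + i) 0); trivial; lia.
Qed.

Lemma describes_steps {Q : Type} (M : machine Q) (t : nat) (z z' : zipper Q)
    (c : configuration Q) :
  describes z c -> zsteps M t z = Some z' ->
  exists c', steps M t c = Some c' /\ describes z' c'.
Proof.
  revert z c; induction t as [|t IH]; intros z c Hc; simpl.
  - intros [= <-]; eauto.
  - destruct (zstep M z) as [z1|] eqn:E; [|discriminate].
    destruct (describes_step M z z1 c Hc E) as (c1 & -> & H1).
    now apply IH.
Qed.

Lemma describes_same {Q : Type} (z : zipper Q) (c1 c2 : configuration Q) :
  describes z c1 -> describes z c2 -> same_configuration c1 c2.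
Proof.
  intros [S1 T1] [S2 T2]; split; [congruence|].
  intros i; rewrite T1, T2; reflexivity.
Qed.

Lemma zsteps_reaches_in {Q : Type} (M : machine Q) (t : nat) (z z' : zipper Q)
    (c c' : configuration Q) :
  describes z c -> describes z' c' -> zsteps M t z = Some z' ->
  reaches_in M t c c'.
Proof.
  intros Hc Hc' H.
  destruct (describes_steps M t z z' c Hc H) as (c1 & E & H1).
  exists c1; split; [assumption|].
  exact (describes_same z' c1 c' H1 Hc').
Qed.

(** Allowing [y'] to differ from [y] in trailing blanks absorbs the zeros that [bin] does not
    write. *)
Lemma describes_written {Q : Type} (x : word) (q : Q) (a : symbol)
    (y y' : word) :
  (forall i, nth i y s0 = nth i y' s0) ->
  describes (Zipper q (rev x) a y') (written x q a y).
Proof.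
  intros Hy; split; [reflexivity|]; intros i; simpl.
  destruct (Z.lt_trichotomy i 0) as [H|[->|H]].
  - rewrite ztape_neg by assumption; simpl zleft.
    destruct (Z.ltb_spec (Z.of_nat (length x) + i) 0).
    + rewrite nth_overflow; [reflexivity|rewrite length_rev; lia].
    + rewrite app_nth1, rev_nth by lia; f_equal; lia.
  - destruct (Z.ltb_spec (Z.of_nat (length x) + 0) 0); [lia|].
    rewrite app_nth2 by lia.
    replace (Z.to_nat (Z.of_nat (length x) + 0) - length x) with 0 by lia.
    reflexivity.
  - rewrite ztape_pos by assumption; simpl zright.
    destruct (Z.ltb_spec (Z.of_nat (length x) + i) 0); [lia|].
    rewrite app_nth2, <- Hy by lia.
    replace (Z.to_nat (Z.of_nat (length x) + i) - length x)
      with (S (Z.to_nat (i - 1))) by lia.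
    reflexivity.
Qed.

(** * Binary words *)

Lemma nth_app_ext (w u v : word) :
  (forall i, nth i u s0 = nth i v s0) ->
  forall i, nth i (w ++ u) s0 = nth i (w ++ v) s0.
Proof.
  intros H; induction w as [|b w IH]; [assumption|].
  intros [|i]; [reflexivity|apply IH].
Qed.

Definition digit (b : symbol) : nat := match b with s0 => 0 | s1 => 1 end.

(* Least significant bit first. *)
Fixpoint value (w : word) : nat :=
  match w with [] => 0 | b :: w' => digit b + 2 * value w' end.

(* Only up to trailing zeros: [bin 0] is empty. *)
Lemma nth_rev_bin_digit (b : symbol) (m i : nat) :
  nth i (rev (bin (digit b + 2 * m))) s0 = nth i (b :: rev (bin m)) s0.
Proof.
  unfold bin.
  replace (N.of_nat (digit b + 2 * m))
    with (N.of_nat (digit b) + 2 * N.of_nat m)%N by lia.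
  destruct b, (N.of_nat m) as [|p]; simpl; rewrite ?rev_app_distr;
    try reflexivity.
  (* What remains is [b = s0], [m = 0]: an empty word against the single digit [s0]. *)
  destruct i as [|[|i]]; reflexivity.
Qed.

(** Turns an argument such as [32 * m + 14] into five explicit low digits followed by the digits of
    an arbitrary [m]. *)
Lemma nth_rev_bin_value (w : word) (m i : nat) :
  nth i (rev (bin (value w + 2 ^ length w * m))) s0 =
  nth i (w ++ rev (bin m)) s0.
Proof.
  revert i; induction w as [|b w IH]; intros i.
  - simpl; repeat f_equal; lia.
  - replace (value (b :: w) + 2 ^ length (b :: w) * m)
      with (digit b + 2 * (value w + 2 ^ length w * m)) by (simpl; lia).
    rewrite nth_rev_bin_digit; apply (nth_app_ext [b]), IH.
Qed.

(** * Sweeps *)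

Arguments wpow : simpl never.

Notation zrun t z z' := (zsteps M6 t z = Some z').

Definition P (n : nat) (Y : word) : zipper state6 :=
  Zipper qF [] s0 (wpow [s1; s0] n ++ Y).

Lemma wpow_S (w u : word) (n : nat) : wpow w (S n) ++ u = w ++ wpow w n ++ u.
Proof. unfold wpow; simpl; now rewrite <- app_assoc. Qed.

Lemma wpow_add (w u : word) (n m : nat) :
  wpow w (n + m) ++ u = wpow w n ++ wpow w m ++ u.
Proof. unfold wpow; now rewrite repeat_app, concat_app, <- app_assoc. Qed.

Lemma wpow_comm (w u : word) (n : nat) :
  wpow w n ++ w ++ u = w ++ wpow w n ++ u.
Proof.
  rewrite <- wpow_S; replace (S n) with (n + 1) by lia.
  rewrite wpow_add; unfold wpow at 3; simpl; now rewrite app_nil_r.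
Qed.

Lemma wpow_shift (a b : symbol) (n : nat) (u : word) :
  a :: wpow [b; a] n ++ u = wpow [a; b] n ++ a :: u.
Proof.
  induction n as [|n IH]; [reflexivity|].
  rewrite !wpow_S; simpl; now rewrite <- IH.
Qed.

(** The [++ []] matches the left word that [sweep_FA] produces from a blank left side. *)
Lemma rev_wpow_pair (a b : symbol) (n : nat) :
  rev (wpow [a; b] n) = wpow [b; a] n ++ [].
Proof.
  induction n as [|n IH]; [reflexivity|].
  change (wpow [a; b] (S n)) with (a :: b :: wpow [a; b] n).
  cbn [rev]; rewrite IH, <- !app_assoc.
  replace (S n) with (n + 1) by lia; now rewrite wpow_add.
Qed.

Lemma P_10 (n : nat) (Y : word) : P n (s1 :: s0 :: Y) = P (n + 1) Y.
Proof. unfold P; now rewrite wpow_add. Qed.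

(** [F] turns [0] into [1] and [A] turns [1] into [0], both moving right, so the alternating word is
    flipped pair by pair. *)
Lemma sweep_FA (n : nat) (l Y : word) :
  zrun (2 * n) (Zipper qF l s0 (wpow [s1; s0] n ++ Y))
    (Zipper qF (wpow [s0; s1] n ++ l) s0 Y).
Proof.
  revert l; induction n as [|n IH]; intros l; [reflexivity|].
  rewrite !wpow_S; replace (2 * S n) with (2 + 2 * n) by lia.
  cbn; rewrite IH; do 2 f_equal; apply (wpow_comm [s0; s1]).
Qed.

(** The head is the first cell of the block followed by [l]; [hd] and [tl] also cover an empty block
    and an empty [l]. *)
Lemma sweep_EF (n : nat) (l r : word) :
  zrun (2 * n)
    (Zipper qE (tl (wpow [s0; s1] n ++ l)) (hd s0 (wpow [s0; s1] n ++ l)) r)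
    (Zipper qE (tl l) (hd s0 l) (wpow [s0; s1] n ++ r)).
Proof.
  revert r; induction n as [|n IH]; intros r; [reflexivity|].
  rewrite !wpow_S; replace (2 * S n) with (2 + 2 * n) by lia.
  cbn; rewrite IH; do 2 f_equal; apply (wpow_comm [s0; s1]).
Qed.

(** Entering the block on a [1] instead of a [0] makes [E] alternate with [D] instead of [F]. *)
Lemma sweep_ED (n : nat) (l r : word) :
  zrun (2 * n) (Zipper qE (wpow [s0; s1] n ++ l) s1 r)
    (Zipper qE l s1 (wpow [s1; s0] n ++ r)).
Proof.
  revert r; induction n as [|n IH]; intros r; [reflexivity|].
  rewrite !wpow_S; replace (2 * S n) with (2 + 2 * n) by lia.
  cbn; rewrite IH; do 2 f_equal; apply (wpow_comm [s1; s0]).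
Qed.

Lemma zrun_eq (t t' : nat) (z z1 z2 : zipper state6) :
  zrun t' z z1 -> t' = t -> z1 = z2 -> zrun t z z2.
Proof. now intros H -> <-. Qed.

(* Normalising after each step: [cbn] on many steps at once duplicates the
   unevaluated halves of the tape at every move. *)
Tactic Notation "run_for" int_or_var(t) := do t (eapply (zsteps_trans M6 1); [cbn; reflexivity|]).
Ltac run_by H := eapply zsteps_trans; [apply H|].
Tactic Notation "run_end" int_or_var(t) := run_for t; exact (eq_refl : zsteps M6 0 _ = _).

(** * Rewriting rules *)

(* Here [t] counts the steps of the turn at the right end; the one final step writes [1] on the
   blank left of the block and restores [F]. *)
Tactic Notation "sweep_right_left" int_or_var(t) :=
  eapply zrun_eq;
  [ run_by sweep_FA; run_for t; run_by sweep_EF; run_end 1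
  | lia
  | unfold P; f_equal; rewrite wpow_shift, wpow_add; reflexivity ].

Lemma P_11 (n : nat) (Y : word) :
  zrun (4 * n + 6) (P n (s1 :: s1 :: Y)) (P (n + 2) Y).
Proof. sweep_right_left 5. Qed.

(** First of the two sweeps of [P_010]: it leaves [11] next to the block, ready for [P_11]. *)
Lemma P_010_111 (n : nat) (Y : word) :
  zrun (4 * n + 10) (P n (s0 :: s1 :: s0 :: Y))
    (P (n + 1) (s1 :: s1 :: s1 :: Y)).
Proof. sweep_right_left 9. Qed.

Lemma P_010 (n : nat) (Y : word) :
  zrun (8 * n + 20) (P n (s0 :: s1 :: s0 :: Y)) (P (n + 3) (s1 :: Y)).
Proof.
  eapply zrun_eq; [run_by P_010_111; apply P_11 | lia | f_equal; lia].
Qed.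

Lemma P_01110 (n : nat) (Y : word) :
  zrun (4 * n + 18) (P n (s0 :: s1 :: s1 :: s1 :: s0 :: Y))
    (P (n + 3) (s1 :: Y)).
Proof. sweep_right_left 17. Qed.

Lemma P_01111101 (n : nat) (Y : word) :
  zrun (4 * n + 34)
    (P n ([s0; s1; s1; s1; s1; s1; s0; s1] ++ Y)) (P (n + 5) Y).
Proof. sweep_right_left 33. Qed.

(** After one sweep the head stays right of the block until [D] reads [1], so [n] enters the time
    only once. *)
Lemma P_halt (n : nat) (Y : word) :
  zrun (2 * n + 43) (P n ([s0; s1; s1; s1; s1; s0; s0; s0; s0] ++ Y))
    (Zipper qH (s1 :: wpow [s0; s1] n ++ []) s0
       (wpow [s1; s0] 2 ++ wpow [s0; s1] 2 ++ Y)).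
Proof. run_by sweep_FA; run_end 43. Qed.

(** * Repeated rules and their quadratic running times *)

Lemma P_0101 (n : nat) (Y : word) :
  zrun (12 * n + 38) (P n (s0 :: s1 :: s0 :: s1 :: Y)) (P (n + 5) Y).
Proof.
  eapply zrun_eq; [run_by P_010; apply P_11 | lia | f_equal; lia].
Qed.

(** Round [i] starts with block length [n + 5 * i] and costs [12 * (n + 5 * i) + 38]; the time is
    the sum over [i < j]. *)
Lemma P_0101_pow (j n : nat) (Y : word) :
  zrun (30 * j ^ 2 + 12 * n * j + 8 * j) (P n (wpow [s0; s1] (2 * j) ++ Y))
    (P (n + 5 * j) Y).
Proof.
  revert n; induction j as [|j IH]; intros n.
  - eapply zrun_eq; [run_end 0 | simpl; lia |].
    f_equal; lia.
  - replace (2 * S j) with (S (S (2 * j))) by lia; rewrite !wpow_S.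
    eapply zrun_eq; [run_by P_0101; apply IH | cbn [Nat.pow]; lia | f_equal; lia].
Qed.

Lemma P_11_pow_even (k : nat) (Y : word) :
  zrun (30 * k ^ 2 + 32 * k + 6)
    (P 0 (s1 :: s1 :: wpow [s0; s1] (2 * k) ++ Y)) (P (5 * k + 2) Y).
Proof.
  eapply zrun_eq; [run_by P_11; apply P_0101_pow | lia | f_equal; lia].
Qed.

(** The unpaired last [01] joins the following [0] to form [010], which [P_010] consumes. *)
Lemma P_11_pow_odd (k : nat) (Y : word) :
  zrun (30 * k ^ 2 + 72 * k + 42)
    (P 0 (s1 :: s1 :: wpow [s0; s1] (2 * k + 1) ++ s0 :: Y))
    (P (5 * k + 5) (s1 :: Y)).
Proof.
  rewrite wpow_add.
  eapply zrun_eq; [run_by P_11_pow_even; apply P_010 | lia | f_equal; lia].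
Qed.

(* The return sweep ends on a [1]; the last three steps flip it and write [11] on two fresh blanks,
   so the old block now lies right of [11] and the new one is empty. *)
Tactic Notation "sweep_to_11" int_or_var(t) :=
  eapply zrun_eq;
  [ run_by sweep_FA; run_for t; run_by sweep_ED; run_end 3
  | lia
  | unfold P; f_equal; rewrite wpow_shift; reflexivity ].

(** The turn reaches back into the last pair of the block, hence the length [n + 1]. *)
Lemma P_00 (n : nat) (Y : word) :
  zrun (4 * n + 19) (P (n + 1) (s0 :: s0 :: Y))
    (P 0 (s1 :: s1 :: wpow [s0; s1] n ++ [s0; s0; s1; s0; s1] ++ Y)).
Proof. rewrite Nat.add_1_r; sweep_to_11 14. Qed.

Lemma P_0110 (n : nat) (Y : word) :
  zrun (4 * n + 17) (P n (s0 :: s1 :: s1 :: s0 :: Y))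
    (P 0 (s1 :: s1 :: wpow [s0; s1] n ++ [s0; s0; s1; s0; s1] ++ Y)).
Proof. sweep_to_11 14. Qed.

Lemma P_0111101 (n : nat) (Y : word) :
  zrun (4 * n + 33) (P n ([s0; s1; s1; s1; s1; s0; s1] ++ Y))
    (P 0 (s1 :: s1 :: wpow [s0; s1] n ++
          [s0; s0; s1; s0; s1; s0; s1; s0] ++ Y)).
Proof. sweep_to_11 30. Qed.

(** * From words back to numbers *)

Lemma describes_C (w : word) (n m p : nat) :
  p = value w + 2 ^ length w * m -> describes (P n (w ++ rev (bin m))) (C n p).
Proof.
  intros ->; apply (describes_written []), nth_app_ext.
  intros i; apply nth_rev_bin_value.
Qed.

(** Reduces a clause to a rewriting of low digits in which the digits of [m] stay untouched. *)
Lemma reaches_in_C (w w' : word) (t n n' m p p' : nat) :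
  zrun t (P n (w ++ rev (bin m))) (P n' (w' ++ rev (bin m))) ->
  p = value w + 2 ^ length w * m -> p' = value w' + 2 ^ length w' * m ->
  reaches_in M6 t (C n p) (C n' p').
Proof.
  intros H Hp Hp'.
  eapply zsteps_reaches_in;
    [apply describes_C, Hp | apply describes_C, Hp' | exact H].
Qed.

Theorem theorem8p1 :
  (forall k m : nat, same_configuration (C k (4 * m + 1)) (C (k + 1) m)) /\
  reaches_in M6 6 (written [] qA s0 []) (C 0 15) /\
  (forall k m : nat,
    reaches_in M6 (4 * k + 6) (C k (4 * m + 3)) (C (k + 2) m) /\
    reaches_in M6 (30 * k ^ 2 + 20 * k + 15)
      (C (2 * k) (4 * m)) (C (5 * k + 2) (2 * m + 1)) /\
    reaches_in M6 (30 * k ^ 2 + 40 * k + 25)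
      (C (2 * k + 1) (4 * m)) (C (5 * k + 2) (32 * m + 20)) /\
    reaches_in M6 (8 * k + 20) (C k (8 * m + 2)) (C (k + 3) (2 * m + 1)) /\
    reaches_in M6 (30 * k ^ 2 + 40 * k + 23)
      (C (2 * k) (16 * m + 6)) (C (5 * k + 2) (32 * m + 20)) /\
    reaches_in M6 (30 * k ^ 2 + 80 * k + 63)
      (C (2 * k + 1) (16 * m + 6)) (C (5 * k + 7) (2 * m + 1)) /\
    reaches_in M6 (4 * k + 18) (C k (32 * m + 14)) (C (k + 3) (2 * m + 1)) /\
    reaches_in M6 (30 * k ^ 2 + 40 * k + 39)
      (C (2 * k) (128 * m + 94)) (C (5 * k + 2) (256 * m + 84)) /\
    reaches_in M6 (30 * k ^ 2 + 80 * k + 79)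
      (C (2 * k + 1) (128 * m + 94)) (C (5 * k + 9) m) /\
    reaches_in M6 (4 * k + 34) (C k (256 * m + 190)) (C (k + 5) m) /\
    reaches_in M6 (2 * k + 43)
      (C k (512 * m + 30))
      (written (wpow [s1; s0] k ++ [s1]) qH s0
         (wpow [s1; s0] 2 ++ wpow [s0; s1] 2 ++ rev (bin m)))).
Proof.
  split; [|split].
  - intros k m.
    (* The low digits [10] of [4 * m + 1] can equally be counted as one more pair of the block. *)
    apply (describes_same (P k ([s1; s0] ++ rev (bin m)))).
    + apply describes_C; simpl; lia.
    + cbn [app]; rewrite P_10; apply (describes_C []); simpl; lia.
  (* The fifth digit [s0] is the blank cell visited by [B], which the zipper keeps although it does
     not change the number 15. *)
  - apply (zsteps_reaches_in M6 6 (Zipper qA [] s0 [])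
             (P 0 ([s1; s1; s1; s1; s0] ++ rev (bin 0)))).
    + apply (describes_written []); reflexivity.
    + apply describes_C; reflexivity.
    + reflexivity.
  - intros k m; repeat apply conj.
    + apply (reaches_in_C [s1; s1] [] _ _ _ m); [apply P_11 | simpl; lia ..].
    + apply (reaches_in_C [s0; s0] [s1] _ _ _ m); [| simpl; lia ..].
      (* [P_00] needs a nonempty block; for [k = 0] the 15 steps are computed directly. *)
      destruct k as [|k]; [reflexivity|].
      replace (2 * S k) with (2 * k + 1 + 1) by lia.
      eapply zrun_eq; [run_by P_00; apply P_11_pow_odd | simpl; lia |].
      (* The remaining [10101] starts with two pairs that extend the block, from [5 * k + 5] to
         [5 * k + 7]. *)
      cbn [app]; rewrite !P_10; f_equal; lia.
    + apply (reaches_in_C [s0; s0] [s0; s0; s1; s0; s1] _ _ _ m);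
        [| simpl; lia ..].
      eapply zrun_eq; [run_by P_00; apply P_11_pow_even | lia | reflexivity].
    + apply (reaches_in_C [s0; s1; s0] [s1] _ _ _ m);
        [apply P_010 | simpl; lia ..].
    + apply (reaches_in_C [s0; s1; s1; s0] [s0; s0; s1; s0; s1] _ _ _ m);
        [| simpl; lia ..].
      eapply zrun_eq; [run_by P_0110; apply P_11_pow_even | lia | reflexivity].
    + apply (reaches_in_C [s0; s1; s1; s0] [s1] _ _ _ m); [| simpl; lia ..].
      eapply zrun_eq; [run_by P_0110; apply P_11_pow_odd | lia |].
      cbn [app]; rewrite !P_10; f_equal; lia.
    + apply (reaches_in_C [s0; s1; s1; s1; s0] [s1] _ _ _ m);
        [apply P_01110 | simpl; lia ..].
    + apply (reaches_in_C [s0; s1; s1; s1; s1; s0; s1]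
               [s0; s0; s1; s0; s1; s0; s1; s0] _ _ _ m); [| simpl; lia ..].
      eapply zrun_eq;
        [run_by P_0111101; apply P_11_pow_even | lia | reflexivity].
    + apply (reaches_in_C [s0; s1; s1; s1; s1; s0; s1] [] _ _ _ m);
        [| simpl; lia ..].
      eapply zrun_eq; [run_by P_0111101; apply P_11_pow_odd | lia |].
      (* Here four pairs [10] are absorbed, which gives [5 * k + 9] and leaves exactly the digits of
         [m]. *)
      cbn [app]; rewrite !P_10; f_equal; lia.
    + apply (reaches_in_C [s0; s1; s1; s1; s1; s1; s0; s1] [] _ _ _ m);
        [apply P_01111101 | simpl; lia ..].
    + eapply zsteps_reaches_in; [| |apply (P_halt k (rev (bin m)))].
      * apply describes_C; simpl; lia.
      * rewrite <- rev_wpow_pair, <- rev_unit.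
        apply describes_written; reflexivity.
Qed.
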